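(* For every integer $k\ge 1$, the odd cycle $C_{2k+1}$ satisfies $$\delta_{\mathrm{VC}}(C_{2k+1})=\frac{1}{2k+1}.$$
   Context: All graphs are finite and simple. $C_{2k+1}$ is the cycle on $2k+1$ vertices. A graph is $H$-free if it contains no (not necessarily induced) subgraph isomorphic to $H$; it is maximal $H$-free if it is $H$-free and adding any missing edge creates a copy of $H$. $\delta(G)$ denotes minimum degree. The VC-dimension $\mathrm{VC}(G)$ of a graph $G$ is the VC-dimension of the set system $\{N_G(v):v\in V(G)\}$ on $V(G)$, i.e. the maximum size of a set $S\subseteq V(G)$ such that $\{N_G(v)\cap S: v\in V(G)\}=2^S$. The VC-dimension threshold $\delta_{\mathrm{VC}}(H)$ is the infimum of all $\gamma\ge 0$ for which there exists a constant $C=C(\gamma,H)$ such that every maximal $H$-free graph $G$ with $\delta(G)\ge\gamma|V(G)|$ satisfies $\mathrm{VC}(G)\le C$. *)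

(* Defs.v *)
From mathcomp Require Import all_boot all_order all_algebra.
From mathcomp Require Import boolp classical_sets reals.

Set Implicit Arguments.
Unset Strict Implicit.
Unset Printing Implicit Defensive.

Import Order.TTheory GRing.Theory Num.Theory.

Record sgraph := SGraph {
  vertex :> finType;
  adj : rel vertex;
  adj_sym : symmetric adj;
  adj_irr : irreflexive adj
}.
Arguments adj {s} x y.

Section CycleGraph.
Variable n : nat.

(* ordS is the cyclic successor on 'I_n. The clause i != j only matters for
   n = 1; for n >= 3 this is the cycle on n vertices. *)
Definition cycle_adj : rel 'I_n :=
  fun i j => (i != j) && ((j == ordS i) || (i == ordS j)).

Fact cycle_adj_sym : symmetric cycle_adj.
Proof. by move=> i j; rewrite /cycle_adj eq_sym orbC. Qed.

Fact cycle_adj_irr : irreflexive cycle_adj.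
Proof. by move=> i; rewrite /cycle_adj eqxx. Qed.

Definition cycle_graph : sgraph := SGraph cycle_adj_sym cycle_adj_irr.

End CycleGraph.

Section AddEdge.
Variables (G : sgraph) (u v : G).

Definition add_edge_adj : rel G :=
  fun x y => (x != y) &&
    [|| adj x y, (x == u) && (y == v) | (x == v) && (y == u)].

Fact add_edge_adj_sym : symmetric add_edge_adj.
Proof.
move=> x y; rewrite /add_edge_adj eq_sym adj_sym; congr (_ && (_ || _)).
by rewrite orbC andbC [(x == u) && _]andbC.
Qed.

Fact add_edge_adj_irr : irreflexive add_edge_adj.
Proof. by move=> x; rewrite /add_edge_adj eqxx. Qed.

Definition add_edge : sgraph := SGraph add_edge_adj_sym add_edge_adj_irr.

End AddEdge.

Definition contains (G H : sgraph) : Prop :=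
  exists f : H -> G, injective f /\ {homo f : x y / adj x y}.

Definition graph_free (H G : sgraph) : Prop := ~ contains G H.

Definition maximal_free (H G : sgraph) : Prop :=
  graph_free H G /\
  forall u v : G, u != v -> ~~ adj u v -> contains (add_edge u v) H.

Definition nbhd (G : sgraph) (v : G) : {set G} := [set w | adj v w].

(* The default value #|G| exceeds every degree when G has a vertex, and makes
   the minimum degree of the empty graph 0. *)
Definition min_degree (G : sgraph) : nat :=
  \big[minn/#|G|]_(v : G) #|nbhd v|.

Definition shattered (G : sgraph) (S : {set G}) : bool :=
  [set nbhd v :&: S | v : G] == powerset S.

Definition VC_dim (G : sgraph) : nat :=
  \max_(S : {set G} | shattered S) #|S|.

Local Open Scope ring_scope.

Definition VC_threshold (R : realType) (H : sgraph) : R :=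
  inf [set gamma : R | 0 <= gamma /\
    exists C : nat, forall G : sgraph,
      maximal_free H G ->
      gamma * #|G|%:R <= (min_degree G)%:R ->
      (VC_dim G <= C)%N]%classic.

(* Main.v *)
Require Import Defs.
From mathcomp Require Import all_boot all_order all_algebra.
From mathcomp Require Import reals.
From mathcomp Require Import boolp zify lra.
From mathcomp Require classical_sets.

(** Upper bound.  In a maximal C_{2k+1}-free graph with minimum degree at least
    (1/(2k+1) + eps) n, two distinct nonadjacent vertices u, v are joined by a
    path p_0, ..., p_{2k}, and by inclusion-exclusion some N(p_i), N(p_j) with
    i < j share a linear number of vertices.  Cauchy-Schwarz then gives a
    positive proportion of the tuples t of any given odd length for which
    p_i, t, p_j is a path.  If j - i is odd, one such t closes up to a
    C_{2k+1}; so j - i is even, and p_{i+1}, ..., p_{j-1} may be replaced by a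
    positive proportion of all t.  Let S be shattered, v_A having trace A on S,
    and choose t and a vertex set B at random.  A positive proportion of the
    pairs (x, A) with x \notin A are joined by a path through t whose part
    before t lies in B and whose part after t avoids B.  The initial and final
    parts of two such paths can be mixed, so if X and F are the sets of the x
    and of the A that occur, no x in X lies in any A in F.  Hence
    #|F| <= 2^(#|S| - #|X|), which bounds #|S|.

    Lower bound.  Join x to v_A by an edge if x \in A and by a path of length
    2k otherwise, and attach to each of the 2k+1 layers of these paths a large
    independent set, the large sets being joined so that the whole graph maps
    to C_{2k+1}.  A (2k+1)-cycle would wind once around, hence stay in the
    paths and end with an edge from x to v_A with x \notin A.  In a maximal
    extension the paths of length 2k forbid the edges x v_A with x \notin A,
    so the shattering survives. *)

Set Implicit Arguments.
Unset Strict Implicit.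
Unset Printing Implicit Defensive.

(** * Cycles in graphs *)

Lemma cycle_nthP (T : Type) (e : rel T) (x0 : T) (c : seq T) :
  reflect (forall i, i < size c -> e (nth x0 c i) (nth x0 c (i.+1 %% size c)))
          (cycle e c).
Proof.
case: c => [|x s]; first by apply: ReflectT.
apply: (iffP (pathP x0)) => /= H i lti.
  have := H i; rewrite size_rcons => /(_ lti).
  have -> : nth x0 (x :: rcons s x) i = nth x0 (x :: s) i.
    by rewrite -rcons_cons nth_rcons /= lti.
  rewrite nth_rcons; case: (ltngtP i (size s)) => [ltis|gti|eqi];
    last by rewrite eqi modnn.
    by rewrite modn_small.
  by move: lti; rewrite ltnS leqNgt gti.
have lti' : i < (size s).+1 by rewrite -(size_rcons s x).
have := H i lti'.
have -> : nth x0 (x :: rcons s x) i = nth x0 (x :: s) i.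
  by rewrite -rcons_cons nth_rcons /= lti'.
rewrite nth_rcons; case: (ltngtP i (size s)) => [ltis|gti|eqi];
  last by rewrite eqi modnn.
  by rewrite modn_small.
by move: lti'; rewrite ltnS leqNgt gti.
Qed.

Lemma cycle_contains (G : sgraph) (c : seq G) (n : nat) :
  size c = n -> cycle adj c -> uniq c -> contains G (cycle_graph n).
Proof.
case: n => [|n] sz cyc un; first by exists (fun i : 'I_0 =>
  match i with Ordinal _ h => match notF h with end end); split=> [[]|[]].
have x0 : G by case: c sz {cyc un}.
exists (fun i : 'I_n.+1 => nth x0 c i); split=> [i j /eqP|i j].
  by rewrite nth_uniq ?sz // => /eqP/val_inj.
have E (a : 'I_n.+1) : adj (nth x0 c a) (nth x0 c (ordS a)).
  by have /cycle_nthP := cyc; move/(_ x0 a); rewrite sz; apply.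
case/andP=> _ /orP[/eqP->|/eqP->]; first exact: E.
by rewrite adj_sym; exact: E.
Qed.

Lemma contains_cycle (G : sgraph) (n : nat) :
  1 < n -> contains G (cycle_graph n) ->
  exists c : seq G, [/\ size c = n, cycle adj c & uniq c].
Proof.
case: n => // n n_gt1 [f [injf homf]].
exists [seq f i | i <- enum 'I_n.+1].
have sz : size [seq f i | i <- enum 'I_n.+1] = n.+1.
  by rewrite size_map size_enum_ord.
split=> //; last by rewrite map_inj_uniq ?enum_uniq.
apply/(cycle_nthP _ (f ord0)) => i; rewrite sz => lti.
have lt1 : i.+1 %% n.+1 < n.+1 by rewrite ltn_mod.
have E j (ltj : j < n.+1) : nth (f ord0) [seq f i | i <- enum 'I_n.+1] j =
  f (Ordinal ltj).
  rewrite (nth_map ord0) ?size_enum_ord //; congr f.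
  by apply/val_inj; rewrite /= nth_enum_ord.
rewrite (E _ lti) (E _ lt1); apply: homf; rewrite /= /cycle_adj -!val_eqE /= eqxx andbT.
move: lti; rewrite ltnS leq_eqVlt => /orP[/eqP->|lti].
  by rewrite modnn; case: (n) n_gt1.
by rewrite modn_small ?ltnS // neq_ltn ltnSn.
Qed.

(** Both orientations of the new edge meet [u], so a path avoiding [u] cannot use it. *)
Lemma add_edge_path (G : sgraph) (u v x : G) (p : seq G) :
  u \notin x :: p ->
  path (@adj (add_edge u v)) x p = path adj x p.
Proof.
elim: p x => //= y p IH x; rewrite !inE !negb_or => /and3P[ux uy up].
rewrite IH ?inE ?negb_or ?uy //; congr (_ && _).
rewrite /add_edge_adj /= (eq_sym x u) (eq_sym y u) (negbTE ux) (negbTE uy) /= andbF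
  !orbF.
by case: eqP => [->|//]; rewrite /= adj_irr.
Qed.

(** The cycle created by adding [u v] must use that edge; deleting it leaves the path. *)
Lemma maximal_free_cycle_path (G : sgraph) (n : nat) (u v : G) :
  2 < n -> maximal_free (cycle_graph n) G -> u != v -> ~~ adj u v ->
  exists p : seq G, [/\ path adj u p, last u p = v, uniq (u :: p) & (size p).+1 = n].
Proof.
move=> n_gt2 [free maxi] neq nadj.
have [c [sz cyc un]] := contains_cycle (ltnW n_gt2) (maxi u v neq nadj).
have nocyc d : size d = n -> uniq d -> ~~ cycle (@adj G) d.
  by move=> szd und; apply/negP => cycd; apply: free;
    apply: cycle_contains szd cycd und.
have uc : u \in c.
  apply: contraT => uc; have /negP[] := nocyc _ sz un.
  case: c sz cyc un uc => // x s _ + _ uc.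
  by rewrite /cycle add_edge_path // inE mem_rcons inE orbA orbb -in_cons.
have [i s rots] := rot_to uc.
have szs : (size s).+1 = n by rewrite -sz -(size_rot i c) rots.
have uns : uniq (u :: s) by rewrite -rots rot_uniq.
have cycs : cycle (@adj (add_edge u v)) (u :: s) by rewrite -rots rot_cycle.
have nocycs := nocyc (u :: s) szs uns.
case: s szs uns cycs nocycs {rots} => [|y s]; first by move=> E; rewrite -E in n_gt2.
case: (lastP s) => [E|{}s z]; first by rewrite -E in n_gt2.
move=> szs uns /=; rewrite !rcons_path !last_rcons.
move: (uns) => /= /and3P[]; rewrite inE mem_rcons inE !negb_or => /and3P[uy uz us] ys _.
have uys : u \notin y :: s by rewrite inE negb_or uy.
have uysz : u \notin y :: rcons s z by rewrite inE mem_rcons inE !negb_or uy uz us.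
rewrite -rcons_path add_edge_path // => /and3P[e1 pys e2] noc.
have aeE a : u != a -> add_edge_adj u v u a = adj u a || (a == v).
  move=> ua; rewrite /add_edge_adj ua eqxx /=.
  by rewrite (eq_sym a u) (negbTE ua) andbF orbF.
have aeE' a : u != a -> add_edge_adj u v a u = adj u a || (a == v).
  by move=> ua; rewrite add_edge_adj_sym aeE.
(* The new edge closes the cycle if [z = v]; otherwise it is the first edge, [y = v], and the path
   is read backwards. *)
have [ezv|nzv] := eqVneq z v.
  exists (y :: rcons s z); split=> //=; last by rewrite last_rcons.
  rewrite pys andbT; have := e1; rewrite aeE // => /orP[//|/eqP yv].
  by move: ys; rewrite mem_rcons inE yv ezv eqxx.
have uz' : adj z u by move: e2; rewrite aeE' // (negbTE nzv) orbF adj_sym.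
have [eyv|nyv] := eqVneq y v; last first.
  move: e1; rewrite aeE // (negbTE nyv) orbF => e1.
  by move: noc; rewrite e1 uz' -rcons_path pys.
exists (rev (y :: rcons s z)); split.
- rewrite rev_cons rev_rcons /= rcons_path adj_sym uz' /=.
  have := rev_path adj y (rcons s z); rewrite last_rcons belast_rcons rev_cons => H.
  have E : path adj z (rcons (rev s) y) = path adj y (rcons s z).
    by rewrite H; apply: eq_path => a b; rewrite adj_sym.
  by rewrite -rcons_path E.
- by rewrite rev_cons last_rcons.
- by move: uns; rewrite [uniq (u :: _)]/= mem_rev rev_uniq.
- by rewrite size_rev.
Qed.

(** * Counting walks between two vertices *)

(** Cauchy-Schwarz, by summing [2 * (h x * h y) <= h x ^ 2 + h y ^ 2] over all pairs. *)
Lemma sqr_sum_le (T : finType) (h : T -> nat) :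
  (\sum_x h x) ^ 2 <= #|T| * \sum_x h x ^ 2.
Proof.
rewrite -(leq_pmul2l (isT : 0 < 2)) expnS expn1 big_distrlr /= big_distrr /=.
have -> : 2 * (#|T| * \sum_x h x ^ 2) = \sum_x \sum_y (h x ^ 2 + h y ^ 2).
  under [RHS]eq_bigr do rewrite big_split /= sum_nat_const.
  by rewrite big_split /= sum_nat_const -big_distrr /= addnn mul2n.
by apply: leq_sum => x _; rewrite big_distrr /=; apply: leq_sum => y _;
  exact: nat_Cauchy.
Qed.

Section Walks.
Variable G : sgraph.
Implicit Types (W Z : {set G}) (y p q : G).

Definition walks_to W r y := [set a : r.-tuple G | path adj y a && (last y a \in W)].

Lemma card_walks_to0 W y : #|walks_to W 0 y| = (y \in W).
Proof.
rewrite -sum1dep_card.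
case: (boolP (y \in W)) => yW; last first.
  by rewrite big1 // => a; rewrite tuple0 /= (negbTE yW).
rewrite (bigD1 [tuple]) //= big1 // => a.
by rewrite [a]tuple0 => /andP[_ /eqP].
Qed.

Lemma card_walks_toS W r y :
  #|walks_to W r.+1 y| = \sum_(z in nbhd y) #|walks_to W r z|.
Proof.
rewrite -sum1dep_card.
under [RHS]eq_bigr do rewrite -sum1dep_card.
rewrite pair_big_dep /=.
rewrite (reindex (fun u : G * r.-tuple G => [tuple of u.1 :: u.2])) /=.
  by apply: eq_bigl => -[z a] /=; rewrite inE andbA.
exists (fun t : r.+1.-tuple G => (thead t, [tuple of behead t])) => [[z a]|t] _ /=.
  by rewrite theadE; congr (_, _); apply/val_inj.
by rewrite [RHS]tuple_eta; apply/val_inj.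
Qed.

(** Seen from their ends in [W], walks extend backwards in at least [D] ways per step. *)
Lemma sum_walks_to W r D :
  (forall v : G, D <= #|nbhd v|) -> #|W| * D ^ r <= \sum_y #|walks_to W r y|.
Proof.
move=> degD; elim: r => [|r IH].
  rewrite muln1 -sum1_card big_mkcond /=; apply: leq_sum => y _.
  by rewrite card_walks_to0; case: (y \in W).
under eq_bigr do rewrite card_walks_toS.
rewrite (exchange_big_dep predT) //= expnS mulnCA.
apply: leq_trans (leq_mul (leqnn D) IH) _.
rewrite big_distrr /=; apply: leq_sum => z _.
rewrite sum_nat_const leq_mul2r; apply/orP; right.
apply: leq_trans (degD z) _; apply: eq_leq; apply: eq_card => y.
by rewrite inE adj_sym; symmetry; change ((z \in nbhd y) = adj y z); rewrite inE.
Qed.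

Definition links p q m := [set t : m.-tuple G | path adj p (rcons t q)].

(** Two walks from [y] into the common neighbourhood, the first one reversed, are glued at [y]; the
    pieces can be read off the result. *)
Lemma sqr_walks_to_links p q r :
  \sum_y #|walks_to (nbhd p :&: nbhd q) r y| ^ 2 <= #|links p q (r + r.+1)|.
Proof.
set W := _ :&: _; pose T := (r.-tuple G)%type.
pose A := [set u : G * (T * T) | (u.2.1 \in walks_to W r u.1) &&
  (u.2.2 \in walks_to W r u.1)].
have -> : \sum_y #|walks_to W r y| ^ 2 = #|A|.
  rewrite -sum1dep_card -(pair_big_dep predT (fun y u => (u.1 \in walks_to W r y) &&
    (u.2 \in walks_to W r y)) (fun _ _ => 1)) /=.
  apply: eq_bigr => y _.
  rewrite -(pair_big_dep (fun u => u \in walks_to W r y) (fun _ u =>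
    u \in walks_to W r y) (fun _ _ => 1)) /=.
  under eq_bigr do rewrite sum1_card.
  by rewrite sum_nat_const.
pose f (u : G * (T * T)) := [tuple of rev u.2.1 ++ u.1 :: u.2.2] : (r + r.+1).-tuple G.
rewrite -(card_in_imset (f := f)); last first.
  move=> [y [a b]] [y' [a' b']] _ _ /(congr1 val) /= /eqP.
  rewrite eqseq_cat ?size_rev ?size_tuple // =>
    /andP[/eqP/(can_inj revK) Ea /eqP[-> Eb]].
  by congr (_, (_, _)); apply/val_inj.
apply: subset_leq_card; apply/subsetP => t /imsetP[[y [a b]]].
rewrite !inE /= => /andP[/andP[pa /andP[lap laq]] /andP[pb /andP[lbp lbq]]] ->.
rewrite rcons_cat rcons_cons -cat_rcons cat_path last_rcons [path adj y _]rcons_path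
  pb adj_sym lbq !andbT /=.
have := rev_path adj y (rcons a p); rewrite last_rcons belast_rcons rev_cons => ->.
rewrite (eq_path (e' := adj)) => [|u v]; last by rewrite adj_sym.
by rewrite rcons_path pa adj_sym lap.
Qed.

End Walks.

(** * Links avoiding a set of vertices *)

(** Each of the [m.+1] factors falls short of [n] by at most [z + m]. *)
Lemma ffact_lower_bound n z m :
  n ^ m.+1 <= (n - z) ^_ m.+1 + m.+1 * (z + m.+1) * n ^ m.
Proof.
have H j : n * n ^ j <= n * (n - z) ^_ j + j * (z + j) * n ^ j ->
   n ^ j.+1 <= (n - z) ^_ j.+1 + j.+1 * (z + j.+1) * n ^ j.
  move=> IH; rewrite expnS; apply: leq_trans IH _.
  have le : (n - z) ^_ j <= n ^ j.
    apply: (@leq_trans ((n - z) ^ j)); last by case: j => // j;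
      rewrite leq_exp2r // leq_subr.
    elim: (j) => // i IH; rewrite ffactnSr expnSr leq_mul //; exact: leq_subr.
  rewrite ffactnSr.
  have := leq_mul le (leqnn (z + j)).
  set X := _ ^_ _; set Y := n ^ j.
  have : X * n <= X * (n - z - j) + X * (z + j) by rewrite -mulnDr leq_mul //; lia.
  nia.
elim: m => [|m IH]; apply: H; first by rewrite ffactn0 muln1 expn0 muln1 leq_addr.
by have := leq_mul (leqnn n) IH; rewrite mulnDr -expnS; move=> /leq_trans; apply;
  rewrite leq_add2l expnS mulnCA.
Qed.

Lemma card_bad_tuples (T : finType) (Z : {set T}) m :
  #|[set t : m.+1.-tuple T | ~~ (all [predC Z] t && uniq t)]|
    <= m.+1 * (#|Z| + m.+1) * #|T| ^ m.
Proof.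
have -> : [set t : m.+1.-tuple T | ~~ (all [predC Z] t && uniq t)] =
  ~: [set t : m.+1.-tuple T | all [predC Z] t & uniq t] by apply/setP => t;
    rewrite !inE.
rewrite cardsCs setCK card_uniq_tuples card_tuple leq_subLR.
have -> : #|[predC Z]| = #|T| - #|Z| by rewrite -(cardC (mem Z)) addKn; apply: eq_card.
exact: ffact_lower_bound.
Qed.

Definition good_links (G : sgraph) (Z : {set G}) (p q : G) m :=
  [set t : m.-tuple G | [&& path adj p (rcons t q), all [predC Z] t & uniq t]].

(** Cauchy-Schwarz on the walks of length [r] into the common neighbourhood gives twice as many
    links as claimed; the size condition on [G] lets the bad tuples spoil at most half of that
    bound. *)
Lemma card_good_links (G : sgraph) (Z : {set G}) (p q : G) r K D :
  (forall v : G, D <= #|nbhd v|) -> #|G| <= K * D ->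
  #|G| <= K * #|nbhd p :&: nbhd q| ->
  2 * (K ^ r.+1) ^ 2 * ((r + r).+1 * (#|Z| + (r + r).+1)) <= #|G| ->
  #|G| ^ (r + r.+1) <= 2 * (K ^ r.+1) ^ 2 * #|good_links Z p q (r + r.+1)|.
Proof.
move=> degD leD leW; set n := #|G| in leD leW *; set Q := (K ^ r.+1) ^ 2 => big.
have n_gt0 : 0 < n by apply/card_gt0P; exists p.
have W1 : n ^ r.+1 <= K ^ r.+1 * \sum_y #|walks_to (nbhd p :&: nbhd q) r y|.
  apply: leq_trans (leq_mul (leqnn _) (sum_walks_to _ _ degD)).
  rewrite !expnS mulnACA leq_mul // -expnMn; case: (r) => // r'.
  by rewrite leq_exp2r.
have W2 : n ^ (r + r.+1) <= Q * #|links p q (r + r.+1)|.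
  rewrite -(leq_pmul2l n_gt0) -expnS -addSn addnn -muln2 expnM.
  have: (n ^ r.+1) ^ 2 <= (K ^ r.+1 * \sum_y #|walks_to (nbhd p :&: nbhd q) r y|) ^ 2
    by rewrite leq_exp2r.
  move/leq_trans; apply; rewrite expnMn mulnCA leq_mul //.
  apply: leq_trans (sqr_sum_le _) _; rewrite leq_mul //.
  exact: sqr_walks_to_links.
have W3 : #|links p q (r + r.+1)| <=
    #|good_links Z p q (r + r.+1)| + (r + r).+1 * (#|Z| + (r + r).+1) * n ^ (r + r).
  rewrite (addnS r r); apply: leq_trans (leq_add (leqnn _) (card_bad_tuples Z (r + r))).
  apply: leq_trans (leq_card_setU _ _); apply: subset_leq_card; apply/subsetP => t.
  by rewrite !inE => ->; rewrite orbN.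
move: W2 W3 big; rewrite addnS expnS; set L := #|links _ _ _|;
  set g := #|good_links _ _ _ _|.
set B := _ * (_ + _); set N := n ^ _ => W2 W3 big.
have := leq_mul (leqnn (2 * Q)) W3; have := leq_mul big (leqnn N); nia.
Qed.

(** * Nonadjacent vertices in maximal C_{2k+1}-free graphs *)

Lemma pairwisePn (T : eqType) (r : rel T) (s : seq T) :
  ~~ pairwise r s ->
  exists l1 a M b l2, s = l1 ++ a :: M ++ b :: l2 /\ ~~ r a b.
Proof.
elim: s => //= x s IH; rewrite negb_and => /orP[/allPn[b bs nr]|/IH].
  case/splitPr: bs => M l2; by exists [::], x, M, b, l2.
by move=> [l1 [a [M [b [l2 [-> nr]]]]]]; exists (x :: l1), a, M, b, l2.
Qed.

(** Truncated inclusion-exclusion: a set meets the union of the later ones in at most [size s * b]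
    points. *)
Lemma sum_card_pairwise (T I : finType) (N : I -> {set T}) (b : nat) (s : seq I) :
  pairwise (fun i j => #|N i :&: N j| <= b) s ->
  \sum_(i <- s) #|N i| <= #|\bigcup_(i <- s) N i| + size s ^ 2 * b.
Proof.
elim: s => [|x s IH] /=; first by rewrite big_nil.
case/andP=> allx /IH{}IH; rewrite !big_cons.
set U := \bigcup_(i <- s) N i in IH *.
have capU : #|N x :&: U| <= size s * b.
  rewrite /U; elim: (s) allx => [|y s' IH'] /=; first by rewrite big_nil setI0 cards0.
  case/andP=> xy /IH' le; rewrite big_cons setIUr mulSn.
  by apply: leq_trans (leq_card_setU _ _) _; exact: leq_add.
have := cardsUI (N x) U; rewrite -!mulnn in IH *; nia.
Qed.

(** If all codegrees were below [#|G| / (size s * q)], the neighbourhoods would cover more than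
    [#|G|] vertices. *)
Lemma exists_pair_codegree (G : sgraph) (s : seq G) (q D : nat) :
  0 < size s -> 0 < q -> (forall v : G, D <= #|nbhd v|) ->
  (q + size s) * #|G| <= size s * q * D ->
  exists l1 a M b l2, s = l1 ++ a :: M ++ b :: l2 /\
    #|G| <= size s * q * #|nbhd a :&: nbhd b|.
Proof.
move=> s_gt0 q_gt0 degD dens.
have n_gt0 : 0 < #|G| by case: s s_gt0 {dens} => // x s _; apply/card_gt0P; exists x.
have K_gt0 : 0 < size s * q by rewrite muln_gt0 s_gt0.
(* The largest [b] with [b * (size s * q) < #|G|], so any codegree above [b] suffices. *)
pose b := #|G|.-1 %/ (size s * q).
have bK : b * (size s * q) < #|G| by rewrite -[ltnRHS](prednK n_gt0) ltnS leq_trunc_div.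
have := @pairwisePn _ (fun i j => #|nbhd i :&: nbhd j| <= b) s.
case: (boolP (pairwise _ s)) => [pw _|_ /(_ isT)]; last first.
  move=> [l1 [a [M [c [l2 [E]]]]]]; rewrite -ltnNge ltn_divLR // => lt.
  by exists l1, a, M, c, l2; split=> //; rewrite mulnC -(prednK n_gt0).
have S1 := sum_card_pairwise pw.
have S2 : size s * D <= \sum_(i <- s) #|nbhd i|.
  by rewrite -sum1_size big_distrl /=; apply: leq_sum => i _; rewrite mul1n.
have S3 : #|\bigcup_(i <- s) nbhd i| <= #|G| by exact: max_card.
exfalso.
have : size s * D <= #|G| + size s ^ 2 * b by lia.
move/(leq_mul (leqnn q)); move: dens bK; rewrite mulnC; set l := size s in s_gt0 *.
set n := #|G| in n_gt0 *.
move=> dens bK le.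
have : l * (b * (l * q)) < l * n by rewrite ltn_pmul2l.
rewrite -mulnn in le; lia.
Qed.

(** * Separating sets and averaging *)

(** Such a [B] is [Y] together with an arbitrary set of elements outside both [Y] and [Z]. *)
Lemma card_separating (T : finType) (Y Z : {set T}) :
  [disjoint Y & Z] ->
  2 ^ #|T| <= 2 ^ (#|Y| + #|Z|) * #|[set B : {set T} | (Y \subset B) &&
    [disjoint Z & B]]|.
Proof.
move=> dis; pose X := ~: (Y :|: Z).
have cX : #|T| = #|Y| + #|Z| + #|X|.
  by rewrite -cardsUI (disjoint_setI0 dis) cards0 addn0 cardsC.
rewrite {1}cX expnD leq_mul // -card_powerset.
rewrite -(card_in_imset (f := fun C => Y :|: C)); last first.
  move=> C C'; rewrite !inE => CX CX' E; apply/setP => x.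
  have /setP/(_ x) := E; rewrite !inE.
  case: (boolP (x \in Y)) => //= xY _.
  have xA (A : {set T}) : A \subset X -> (x \in A) = false.
    by move=> /subsetP AX; apply/negP => /AX; rewrite !inE xY.
  by rewrite !xA.
apply: subset_leq_card; apply/subsetP => B /imsetP[C]; rewrite !inE => CX ->.
rewrite subsetUl disjoint_sym disjoints_subset subUset -disjoints_subset dis /=.
by apply: subset_trans CX _; rewrite setCS subsetUr.
Qed.

(** Double counting of the pairs with [u \in R x]. It replaces the random choices: first of a shape
    [(i, r)], then of [(t, B)]. *)
Lemma averaging (T U : finType) (M : {set T}) (R : T -> {set U}) (c : nat) :
  0 < #|U| -> (forall x, x \in M -> #|U| <= c * #|R x|) ->
  exists u, #|M| <= c * #|[set x in M | u \in R x]|.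
Proof.
move=> /card_gt0P[u0 _] H; apply: contrapT => /forallNP no.
have lt u : c * #|[set x in M | u \in R x]| < #|M| by rewrite ltnNge; apply/negP/no.
have : \sum_u c * #|[set x in M | u \in R x]| < \sum_(u : U) #|M|.
  rewrite (bigD1 u0) // [ltnRHS](bigD1 u0) //= -addSn leq_add //.
  by apply: leq_sum => u _; exact: ltnW.
rewrite ltnNge => /negP; apply.
have E u : #|[set x in M | u \in R x]| = \sum_(x in M) (u \in R x).
  rewrite -sum1_card big_mkcond [RHS]big_mkcond /=; apply: eq_bigr => x _.
  by rewrite inE; case: (x \in M); case: (u \in R x).
rewrite -big_distrr /= (eq_bigr _ (fun u _ => E u)) exchange_big big_distrr /=.
rewrite sum_nat_const mulnC -sum_nat_const; apply: leq_sum => x xM.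
apply: leq_trans (H x xM) _; rewrite leq_mul // -sum1_card big_mkcond /=.
by apply: leq_sum => u _; case: (u \in R x).
Qed.

(** * Mixable paths *)

Section Mixing.
Variable G : sgraph.

(* A [u]-[v] path on [l] vertices whose vertices number [i+1, ..., i+m] are [t];
   [B] keeps the initial part of one such path disjoint from the final part of
   another. *)
Definition mixable (l i m : nat) (u v : G) (t : m.-tuple G) (B : {set G}) : Prop :=
  exists s1 s2 : seq G, [/\ size s1 = i, (i + m + size s2).+2 = l,
    path adj u (s1 ++ t ++ rcons s2 v), uniq (u :: s1 ++ t ++ rcons s2 v)
    & all (mem B) (u :: s1) && all [predC B] (rcons s2 v)].

(** The second path up to [t] and the first one from [t] on form a path from [u'] to [v] on [l]
    vertices, as [B] keeps the two pieces disjoint; the edge [u' v] would close it. *)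
Lemma mixable_nonadj l i m u v u' v' (t : m.+1.-tuple G) (B : {set G}) :
  graph_free (cycle_graph l) G ->
  mixable l i u v t B -> mixable l i u' v' t B -> ~~ adj u' v.
Proof.
move=> free [s1 [s2 [sz1 sz2 pa un /andP[sB sC]]]] [s1' [s2' [sz1' sz2' pa' un'
  /andP[sB' sC']]]].
apply/negP => uv; apply: free.
apply: (@cycle_contains _ (u' :: s1' ++ t ++ rcons s2 v)).
- by rewrite /= !size_cat size_rcons size_tuple sz1' -sz2 !addnA !addnS.
- rewrite (cycle_path u') /= !last_cat last_rcons adj_sym uv /=.
  (* The paths are spliced at the first vertex of [t], which exists because [t] has positive
     length. *)
  move: pa pa'; rewrite !cat_path; case/tupleP: t un un' {uv} => y t _ _.
  by rewrite /= => /andP[_ /andP[_ ->]] /andP[-> /andP[-> _]].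
- move: un un'; rewrite -!cat_cons !cat_uniq !has_cat !negb_or.
  move=> /and3P[_ _ /and3P[ut h1 ur]] /and3P[-> /andP[h2 _] _].
  rewrite ut h1 ur h2 /= !andbT; apply/hasPn => x xs.
  by apply/negP => xs'; have /negP[] := allP sC x xs; exact: (allP sB').
Qed.

Variables (k q D : nat).
Hypotheses (k_gt0 : 0 < k) (q_gt0 : 0 < q) (degD : forall v : G, D <= #|nbhd v|).
Let l := (k + k).+1.
Let K := l * q.
(** In fractions, [D / #|G| >= 1 / l + 1 / q]: the excess over the threshold is [1 / q]. *)
Hypothesis dens : (q + l) * #|G| <= l * q * D.
Hypothesis Gmax : maximal_free (cycle_graph l) G.
Hypothesis big : 2 * (K ^ k.+1) ^ 2 * (l * (l + l)) <= #|G|.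

Lemma degree_dense : #|G| <= K * D.
Proof. by apply: leq_trans dens; rewrite leq_pmull // addn_gt0 q_gt0. Qed.

Lemma good_links_dense (Z : {set G}) a b r :
  r <= k -> #|Z| <= l -> #|G| <= K * #|nbhd a :&: nbhd b| ->
  #|G| ^ (r + r.+1) <= 2 * (K ^ k.+1) ^ 2 * #|good_links Z a b (r + r.+1)|.
Proof.
move=> rk Zl ab.
have K_gt0 : 0 < K by rewrite muln_gt0.
have leK : 2 * (K ^ r.+1) ^ 2 <= 2 * (K ^ k.+1) ^ 2.
  by rewrite leq_mul2l /= leq_exp2r // leq_pexp2l.
have := @card_good_links G Z a b r K D degD degree_dense ab.
move=> /(_ _)/leq_trans; apply; last by rewrite leq_mul2r leK orbT.
apply: leq_trans big; rewrite leq_mul // leq_mul // ?ltnS ?leq_add // ltnS leq_add //.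
Qed.

(** Let [M] be the stretch of the path between two vertices of large codegree. If its size is odd it
    is dropped, making room for links of that size; if even, a link closes it to a forbidden
    cycle. *)
Lemma nonadj_link (u v : G) : u != v -> ~~ adj u v ->
  exists (r : nat) (l1 : seq G) (a b : G) (l2 : seq G),
    [/\ r <= k, (size l1 + (r + r.+1) + size l2).+2 = l, uniq (l1 ++ a :: b :: l2),
        [/\ head a l1 = u, last b l2 = v, sorted adj (rcons l1 a) & path adj b l2]
      & #|G| <= K * #|nbhd a :&: nbhd b|].
Proof.
move=> neq nadj.
have [|p [pp lp unp szp]] := maximal_free_cycle_path _ Gmax neq nadj;
  first by rewrite /l; move: k_gt0; clear; lia.
have [| |||l1 [a [M [b [l2 [E ab]]]]]] := @exists_pair_codegree G (u :: p) q D => //=.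
  by rewrite szp.
rewrite /= szp -/l -/K in ab.
have szE : (size l1 + size M + size l2).+2 = l.
  by have := congr1 size E; rewrite /= szp size_cat /= size_cat /= => ->; clear; lia.
have srt : sorted adj (l1 ++ a :: M ++ b :: l2) by rewrite -E.
have un : uniq (l1 ++ a :: M ++ b :: l2) by rewrite -E.
have srt1 : sorted adj (rcons l1 a).
  by move: srt; rewrite -cat_rcons => /cat_sorted2[].
have srt2 : path adj a (M ++ b :: l2).
  by move: srt => /cat_sorted2[_].
have srt3 : path adj b l2 by move: srt2; rewrite cat_path /= => /and3P[].
have unab : uniq (l1 ++ a :: b :: l2).
  apply: subseq_uniq un; rewrite cat_subseq //= eqxx.
  by rewrite -[b :: l2]cat0s cat_subseq // sub0seq.
have [oddM|evenM] := boolP (odd (size M)).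
  exists (size M)./2, l1, a, b, l2.
  have szM : (size M)./2 + (size M)./2.+1 = size M by move: oddM; clear; lia.
  rewrite szM; split=> //; first by move: szE; rewrite /l; clear; lia.
  split=> //; first by case: (l1) E => [|x l1'] /= [].
  by have := congr1 (last u) E; rewrite last_cat /= last_cat /= lp => ->.
exfalso.
(* Chosen so that [a], [M], [b] and a link on [r + r.+1] new vertices make up [l] vertices. *)
pose r := k - (size M)./2 - 1.
have rk : r <= k by rewrite /r; clear; lia.
have szr : (r + r.+1 + size M).+2 = l.
  by rewrite /r /l; move: szE evenM k_gt0; rewrite /l; clear; lia.
have Zl : #|[set x in u :: p]| <= l by rewrite cardsE (leq_trans (card_size _)) //= szp.
have := @good_links_dense [set x in u :: p] b a r rk Zl.
rewrite setIC => /(_ ab) cnt.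
have : 0 < #|good_links [set x in u :: p] b a (r + r.+1)|.
  rewrite lt0n; apply/eqP => E0; move: cnt;
    rewrite E0 muln0 leqn0 expn_eq0 => /andP[/eqP G0 _].
  by have : #|G| > 0 by [apply/card_gt0P; exists u]; rewrite G0.
case/card_gt0P=> t; rewrite inE => /and3P[pt /allP at_ ut].
case: Gmax => free _; apply: free.
apply: (@cycle_contains _ (a :: M ++ b :: t)).
- by rewrite /= size_cat /= size_tuple; move: szr; clear; lia.
- rewrite /= rcons_cat /= cat_path /= pt andbT.
  by move: srt2; rewrite cat_path /= => /and3P[-> ->].
- rewrite -cat_rcons -cat_cons cat_uniq ut andbT; apply/andP; split.
    apply: subseq_uniq un; rewrite -[a :: rcons M b]cat0s; apply: cat_subseq;
      first exact: sub0seq.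
    rewrite /= eqxx -cats1; apply: cat_subseq; first exact: subseq_refl.
    by rewrite /= eqxx; exact: sub0seq.
  apply/hasPn => x xt; have := at_ x xt; rewrite [_ x]/= in_set E; apply: contra.
  by rewrite mem_cat !inE mem_rcons mem_cat !inE => /or3P[->|->|->]; rewrite ?orbT.
Qed.

Definition mix_set (i r : nat) (u v : G) :=
  [set w : (r + r.+1).-tuple G * {set G} | `[< mixable l i u v w.1 w.2 >]].

(** The factor [2 * (K ^ k.+1) ^ 2] pays for [t], a link avoiding the rest of the path, and [2 ^ l]
    for [B], which must contain the part before [t] and avoid the part after it. *)
Lemma mix_set_dense (u v : G) : u != v -> ~~ adj u v ->
  exists (i : 'I_l) (r : 'I_k.+1),
    #|{: (r + r.+1).-tuple G * {set G}}| <=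
      2 * (K ^ k.+1) ^ 2 * 2 ^ l * #|mix_set i r u v|.
Proof.
move=> neq nadj.
have [r [l1 [a [b [l2 [rk sz un [hd la srt1 srt2] ab]]]]]] := nonadj_link neq nadj.
have il : size l1 < l by move: sz; clear; lia.
exists (Ordinal il); exists (Ordinal (rk : r < k.+1)) => /=.
pose Y := [set x in rcons l1 a]; pose Y' := [set x in b :: l2].
have un' : uniq (rcons l1 a ++ b :: l2) by rewrite cat_rcons.
have dis : [disjoint Y & Y'].
  apply/pred0P => x /=; rewrite !inE.
  move: un'; rewrite cat_uniq => /and3P[_ /hasPn h _].
  by apply/negP => /andP[xY xY']; have := h x; rewrite /= inE xY' xY => /(_ isT).
have cY : #|Y| + #|Y'| <= l.
  apply: (@leq_trans (size (rcons l1 a) + size (b :: l2))).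
    by rewrite !cardsE leq_add // card_size.
  by rewrite size_rcons /=; move: sz; clear; lia.
have cYU : #|Y :|: Y'| <= l by apply: leq_trans (leq_card_setU _ _) cY.
have H1 := good_links_dense rk cYU ab.
have H2 := card_separating dis.
set Bs := [set B | _] in H2.
have H3 : #|setX (good_links (Y :|: Y') a b (r + r.+1)) Bs| <=
  #|mix_set (size l1) r u v|.
  apply: subset_leq_card; apply/subsetP => -[t B]; rewrite !inE /=.
  move=> /andP[/and3P[pt /allP at_ ut] /andP[/subsetP YB dB]].
  apply/asboolP.
  have atE x : x \in val t -> x \notin rcons l1 a ++ b :: l2.
    by move/at_; rewrite !inE mem_cat.
  have [s1 E1] : exists s1, rcons l1 a = u :: s1.
    by case: (l1) hd => [|y l1'] /= <-; [exists [::]|exists (rcons l1' a)].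
  have [s2 E2] : exists s2, b :: l2 = rcons s2 v.
    by rewrite lastI la; exists (belast b l2).
  exists s1, s2.
  have sz1 : size s1 = size l1 by have := congr1 size E1; rewrite size_rcons => -[].
  have sz2 : size s2 = size l2 by have := congr1 size E2; rewrite size_rcons => -[].
  split=> //=; first by rewrite sz2.
  - have -> : path adj u (s1 ++ t ++ rcons s2 v) =
    sorted adj (rcons l1 a ++ t ++ b :: l2) by rewrite E1 E2.
    rewrite cat_rcons.
    have E : l1 ++ a :: t ++ b :: l2 = l1 ++ a :: rcons t b ++ l2 by rewrite cat_rcons.
    rewrite E; clear E.
    have -> : sorted adj (l1 ++ a :: rcons t b ++ l2) = sorted adj (rcons l1 a) &&
      path adj a (rcons t b ++ l2).
      by case: (l1) => //= y s; rewrite cat_path rcons_path /= andbA.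
    by rewrite srt1 cat_path pt last_rcons srt2.
  - have -> : (u \notin s1 ++ t ++ rcons s2 v) && uniq (s1 ++ t ++ rcons s2 v) =
    uniq (rcons l1 a ++ t ++ b :: l2) by rewrite E1 E2.
    rewrite uniq_catCA cat_uniq ut un' andbT /=.
    apply/hasPn => x; apply: contraTN; exact: atE.
  - apply/andP; split.
      have : all (mem B) (rcons l1 a) by apply/allP => x xl; apply: YB; rewrite inE.
      by rewrite E1.
    rewrite -E2; apply/allP => x xl; apply/negP => xB.
    by move: dB => /pred0P/(_ x); rewrite /= !inE xB andbT => /negP[]; rewrite -in_cons.
apply: leq_trans (leq_mul (leqnn _) H3); rewrite cardsX card_prod card_tuple mulnACA
  leq_mul //.
rewrite (_ : #|{set G}| = 2 ^ #|G|); last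
  by rewrite -[LHS]cardsT -powersetT card_powerset cardsT.
by apply: leq_trans H2 _; rewrite leq_mul2r leq_pexp2l ?orbT.
Qed.

End Mixing.

(** * The upper bound *)

(** Of the [2 ^ (#|S| - 1)] subsets avoiding [x], discarding one leaves at least [2 ^ (#|S| - 2)].
    In the application [N x] is the trace of [x], discarded so that [x] differs from [v_A]. *)
Lemma card_nonincident (T : finType) (S : {set T}) (N : T -> {set T}) :
  1 < #|S| ->
  #|S| * 2 ^ (#|S| - 2) <=
    #|[set w : T * {set T} | [&& w.1 \in S, w.2 \subset S :\ w.1 & w.2 != N w.1]]|.
Proof.
move=> S_gt1; rewrite -sum1dep_card -(pair_big_dep (fun x => x \in S)
  (fun x (A : {set T}) => (A \subset S :\ x) && (A != N x)) (fun _ _ => 1)) /=.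
rewrite -sum_nat_const; apply: leq_sum => x xS; rewrite sum1dep_card.
have -> : [set A : {set T} | (A \subset S :\ x) & (A != N x)] =
  powerset (S :\ x) :\ N x.
  by apply/setP => A; rewrite !inE andbC.
have := cardsD1 (N x) (powerset (S :\ x)); rewrite card_powerset.
have := cardsD1 x S; rewrite xS => ->.
case: #|S :\ x| S_gt1 (cardsD1 x S) => [|d] S_gt1; rewrite xS => E;
  first by rewrite E in S_gt1.
rewrite subSS subSS subn0 expnS => H.
have : 0 < 2 ^ d by rewrite expn_gt0.
by move: H; case: (N x \in _) => /=; lia.
Qed.

Lemma double_le_exp m : 2 * m <= 2 ^ m.
Proof.
case: m => [|m] //; rewrite expnS leq_mul2l /=.
elim: m => // m IH; rewrite expnS; lia.
Qed.

(** The first term makes [G] large enough for counting links; the second exceeds twice the number of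
    shapes [(i, r)] times the loss in [mix_set_dense]. *)
Definition VC_bound (k q : nat) :=
  let l := (k + k).+1 in
  maxn (2 * ((l * q) ^ k.+1) ^ 2 * (l * (l + l)))
       (2 * (l * k.+1 * (2 * ((l * q) ^ k.+1) ^ 2 * 2 ^ l))).+1.

Lemma min_degree_le (G : sgraph) (v : G) : min_degree G <= #|nbhd v|.
Proof.
rewrite /min_degree; have : v \in index_enum G by exact: mem_index_enum.
elim: (index_enum G) => // x s IH; rewrite inE big_cons geq_min => /orP[/eqP->|/IH ->].
  by rewrite leqnn.
by rewrite orbT.
Qed.

Lemma VC_dim_bounded (G : sgraph) (k q : nat) :
  0 < k -> 0 < q -> (q + (k + k).+1) * #|G| <= (k + k).+1 * q * min_degree G ->
  maximal_free (cycle_graph (k + k).+1) G -> VC_dim G <= VC_bound k q.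
Proof.
move=> k_gt0 q_gt0 dens Gmax; apply/bigmax_leqP => S shS.
rewrite leqNgt; apply/negP; rewrite /VC_bound /= gtn_max.
set l := (k + k).+1 in dens Gmax *; set c0 := 2 * _ ^ 2 * 2 ^ l; set c := l * k.+1 * c0.
case/andP=> big dbig.
have S_gt1 : 1 < #|S| by apply: leq_trans dbig; rewrite !ltnS.
have {}big : 2 * ((l * q) ^ k.+1) ^ 2 * (l * (l + l)) <= #|G|.
  by apply: leq_trans (ltnW big) _; exact: max_card.
have [x0 x0S] : exists x, x \in S by apply/card_gt0P; exact: ltnW.
have /fin_all_exists[v vP] : forall A : {set G}, exists y, A \subset S -> nbhd y :&:
  S = A.
  move=> A; case: (boolP (A \subset S)) => AS; last by exists x0.
  have : A \in powerset S by rewrite inE.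
  by rewrite -(eqP shS) => /imsetP[y _ ->]; exists y.
pose M := [set w : G * {set G} | [&& w.1 \in S, w.2 \subset S :\ w.1 & w.2 != nbhd
  w.1 :&: S]].
have cM := card_nonincident (fun x => nbhd x :&: S) S_gt1; rewrite -/M in cM.
have subS w : w \in M -> w.2 \subset S.
  by rewrite inE => /and3P[_ sub _]; apply: subset_trans sub (subsetDl _ _).
have dense (w : G * {set G}) : w \in M -> exists (i : 'I_l) (r : 'I_k.+1),
    #|{: (r + r.+1).-tuple G * {set G}}| <= c0 * #|mix_set k i r w.1 (v w.2)|.
  move=> wM; have AS := subS _ wM; move: wM; rewrite inE => /and3P[xS sub neq].
  have vA := vP _ AS.
  apply: (mix_set_dense k_gt0 q_gt0 (@min_degree_le G) dens Gmax big).
    by apply: contraNneq neq => ->; rewrite vA.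
  apply/negP => xv; have : w.1 \in nbhd (v w.2) :&: S by rewrite !inE adj_sym xv.
  by rewrite vA => /(subsetP sub); rewrite !inE eqxx.
(* The shapes, that is position [i] and size [r + r.+1] of [t], that are dense for [w]. One shape is
   then fixed, so that the paths can be mixed. *)
pose R1 (w : G * {set G}) := [set u : 'I_l * 'I_k.+1 |
   #|{: (u.2 + u.2.+1).-tuple G * {set G}}| <= c0 * #|mix_set k u.1 u.2 w.1 (v w.2)|].
have [||[i r]] := @averaging _ _ M R1 (l * k.+1).
- by rewrite card_prod !card_ord.
- move=> w /dense[i [r H]]; rewrite card_prod !card_ord leq_pmulr //.
  by apply/card_gt0P; exists (i, r); rewrite inE.
set M1 := [set w in M | _] => cM1.
have [||[t B]] := @averaging _ _ M1 (fun w => mix_set k i r w.1 (v w.2)) c0.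
- by apply/card_gt0P; exists ([tuple of nseq (r + r.+1) x0], set0).
- by move=> w; rewrite inE => /andP[_]; rewrite inE.
set M2 := [set w in M1 | _] => cM2.
pose X := [set w.1 | w in M2]; pose F := [set w.2 | w in M2].
have M2P w : w \in M2 -> w \in M /\ mixable l i w.1 (v w.2) t B.
  by rewrite inE => /andP[]; rewrite inE => /andP[wM _]; rewrite inE => /asboolP.
have XS : X \subset S.
  by apply/subsetP => x /imsetP[w /M2P[]]; rewrite inE => /and3P[xS _ _] _ ->.
(* Mixing the start of the path for [w'] with the end of the path for [w] shows [w'.1] nonadjacent
   to [v w.2], so [w'.1] is not in [w.2]. *)
have FX : F \subset powerset (S :\: X).
  apply/subsetP => A /imsetP[w /M2P[wM mw] ->]; rewrite inE subsetD subS //=.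
  rewrite disjoint_sym disjoints_subset; apply/subsetP =>
    x /imsetP[w' /M2P[wM' mw'] ->].
  rewrite inE -(vP _ (subS _ wM)) !inE negb_and; apply/orP; left.
  move: t mw mw' {cM2 M2 X F M2P XS}; rewrite addnS => t mw mw'.
  rewrite adj_sym; exact: mixable_nonadj Gmax.1 mw mw'.
have cXF : #|M2| <= #|X| * 2 ^ (#|S| - #|X|).
  apply: (@leq_trans #|setX X F|).
    apply: subset_leq_card; apply/subsetP => -[x A] wM2; rewrite inE /=.
    by apply/andP; split; apply/imsetP; exists (x, A).
  rewrite cardsX leq_mul2l; apply/orP; right.
  by rewrite -(cardsDS XS) -card_powerset subset_leq_card.
have cX : #|X| <= #|S| := subset_leq_card XS.
have main : #|S| * 2 ^ (#|S| - 2) <= c * (#|X| * 2 ^ (#|S| - #|X|)).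
  apply: leq_trans cM _; apply: leq_trans cM1 _; rewrite /c -[leqRHS]mulnA leq_mul2l;
    apply/orP; right.
  by apply: leq_trans cM2 _; rewrite leq_mul.
(* By [2 * #|X| <= 2 ^ #|X|], the right side of [main] is at most [2 * c * 2 ^ (#|S| - 2)], whence
   [#|S| <= 2 * c]. *)
have : 2 * (#|S| * 2 ^ (#|S| - 2)) <= 2 * (2 * c) * 2 ^ (#|S| - 2).
  apply: (@leq_trans (2 * (c * (#|X| * 2 ^ (#|S| - #|X|)))));
    first by rewrite leq_mul2l main.
  have E : 2 ^ #|S| = 4 * 2 ^ (#|S| - 2) by rewrite -(expnD 2 2) subnKC.
  have : 2 * #|X| * 2 ^ (#|S| - #|X|) <= 4 * 2 ^ (#|S| - 2).
    by rewrite -E -{2}(subnKC cX) expnD leq_mul // double_le_exp.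
  move/(leq_mul (leqnn c)); clear; lia.
rewrite mulnA leq_pmul2r ?expn_gt0 // leq_pmul2l //.
by rewrite leqNgt (ltn_trans _ dbig).
Qed.

(** * Maximal extensions and winding *)

(** Edges are added one at a time while [H] does not appear, until the nonadjacent pairs run out. *)
Lemma maximal_free_extension (H : sgraph) (T : finType) (e : rel T)
    (se : symmetric e) (ie : irreflexive e) :
  graph_free H (SGraph se ie) ->
  exists (e' : rel T) (se' : symmetric e') (ie' : irreflexive e'),
    subrel e e' /\ maximal_free H (SGraph se' ie').
Proof.
have [N] := ubnP #|[set w : T * T | ~~ e w.1 w.2]|.
elim: N e se ie => // N IH e se ie lt free.
have [maxi|] := pselect (forall u v : SGraph se ie, u != v -> ~~ adj u v ->
                           contains (add_edge u v) H).
  by exists e, se, ie; split=> //; split.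
move=> /existsNP[u /existsNP[v /not_implyP[neq /not_implyP[nadj nocont]]]].
have sub : subrel e (@adj (add_edge u v)).
  move=> x y exy; rewrite /= /add_edge_adj /= exy andbT.
  by apply: contraTneq exy => ->; rewrite ie.
have [|//|e' [se' [ie' [sub' maxi]]]] := IH _ (@adj_sym (add_edge u v)) (@adj_irr
  (add_edge u v)).
  apply: leq_trans (proper_card _) lt; apply/properP; split.
    by apply/subsetP => -[x y]; rewrite !inE; apply: contra; exact: sub.
  by exists (u, v); rewrite !inE //= /add_edge_adj neq !eqxx /= orbT.
by exists e', se', ie'; split=> // x y /sub/sub'.
Qed.

Lemma iter_ordS (n j : nat) (i : 'I_n) : iter j (@ordS n) i = (i + j) %% n :> nat.
Proof.
elim: j => [|j IH]; first by rewrite addn0 modn_small.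
by rewrite iterS /= IH -addn1 modnDml addn1 addnS.
Qed.

Lemma iter_ordS_id (n : nat) (i : 'I_n) : iter n (@ordS n) i = i.
Proof. by apply/val_inj; rewrite /= iter_ordS modnDr modn_small. Qed.

Lemma iter_ord_pred_id (n : nat) (i : 'I_n) : iter n (@ord_pred n) i = i.
Proof.
have K m : iter m (@ord_pred n) (iter m (@ordS n) i) = i.
  by elim: m => // m IH; rewrite iterSr iterS ordSK IH.
by rewrite -{1}(iter_ordS_id i) K.
Qed.

(* The number [a] of forward steps satisfies [2 a = 0] modulo the odd length,
   so a closed walk of that length around the cycle goes one way only. *)
Lemma cycle_steps (n : nat) (g : 'I_n -> nat) :
  odd n -> (forall i, g (ordS i) = (g i).+1 %[mod n] \/ g i =
    (g (ordS i)).+1 %[mod n]) ->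
  (forall i, g (ordS i) = (g i).+1 %[mod n]) \/ (forall i, g i =
    (g (ordS i)).+1 %[mod n]).
Proof.
move=> oddn steps; pose P i := g (ordS i) == (g i).+1 %[mod n].
have modS (F1 F2 : 'I_n -> nat) : (forall i, F1 i = F2 i %[mod n]) ->
    \sum_i F1 i = \sum_i F2 i %[mod n].
  move=> E; apply: (big_ind2 (fun x y => x = y %[mod n])) => // x1 x2 y1 y2 E1 E2.
  by rewrite -modnDm E1 E2 modnDm.
(* A forward step adds 1 on the right, a backward one on the left; cancelling the equal sums of [g]
   makes their numbers congruent. *)
have : \sum_i (g (ordS i) + ~~ P i) = \sum_i (g i + P i) %[mod n].
  apply: modS => i; case: (boolP (P i)) => /= [/eqP E|nP]; first by rewrite addn0 addn1.
  by case: (steps i) => E; [rewrite /P E eqxx in nP|rewrite addn1 addn0 E].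
rewrite !big_split /= -(reindex_inj (h := @ordS n) (F := g) (P := predT)) /=;
  last exact: can_inj (@ordSK n).
move/eqP; rewrite eqn_modDl => /eqP.
have : \sum_i ~~ P i + \sum_i P i = n.
  rewrite -big_split /= -[RHS]card_ord -sum1_card; apply: eq_bigr => i _.
  by case: (P i).
set a := \sum_i P i; set b := \sum_i ~~ P i => ab mod_ab.
have : n %| a.
  have : n %| 2 * a.
    have : b + a = a + a %[mod n] by rewrite -modnDm mod_ab modnDm.
    by rewrite ab modnn addnn -mul2n /dvdn => <-.
  by rewrite Gauss_dvdr // coprimen2.
have sum0 (Q : 'I_n -> bool) : \sum_i Q i = 0 -> forall i, Q i = false.
  by move=> /eqP; rewrite sum_nat_eq0 => /forallP H i; have := H i; case: (Q i).
have [a0 _|a_gt0 /(dvdn_leq a_gt0) le] := posnP a.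
  by right=> i; case: (steps i) => // /eqP; rewrite -/(P i) (sum0 P a0).
left=> i; apply/eqP; rewrite -/(P i); apply: negbFE.
apply: (sum0 (fun i => ~~ P i)); rewrite -/b; lia.
Qed.

(** The cycle is reversed if [pos] decreases along it, then shifted to start at position 0. *)
Lemma cycle_winding (T : Type) (e : rel T) (pos : T -> nat) (n : nat) (f : 'I_n -> T) :
  symmetric e -> odd n -> (forall x, pos x < n) ->
  (forall x y, e x y -> pos y = (pos x).+1 %[mod n] \/ pos x = (pos y).+1 %[mod n]) ->
  (forall i, e (f i) (f (ordS i))) ->
  exists c : nat -> T, [/\ forall j, e (c j) (c j.+1), c n = c 0
    & forall j, pos (c j) = j %% n].
Proof.
move=> sym oddn ltpos hom fe.
have [s [es poss ids]] : exists s : 'I_n -> 'I_n, [/\ forall i, e (f i) (f (s i)),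
    forall i, pos (f (s i)) = (pos (f i)).+1 %[mod n] & forall i, iter n s i = i].
  case: (@cycle_steps n (pos \o f) oddn (fun i => hom _ _ (fe i))) => H.
    by exists (@ordS n); split=> // i; exact: iter_ordS_id.
  exists (@ord_pred n); split=> i; last exact: iter_ord_pred_id.
    by rewrite sym -{2}(ord_predK i).
  by have := H (ord_pred i); rewrite /= ord_predK.
have n_gt0 : 0 < n by case: (n) oddn.
pose z := Ordinal n_gt0.
have posi j : pos (f (iter j s z)) = pos (f z) + j %[mod n].
  elim: j => [|j IH]; first by rewrite addn0.
  by rewrite iterS poss -addn1 -modnDml IH modnDml addn1 addnS.
pose i0 := iter (n - pos (f z)) s z.
exists (fun j => f (iter j s i0)); split=> [j|//|j].
- by rewrite iterS.
- by rewrite ids.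
rewrite -[LHS](modn_small (ltpos _)) /i0 -iterD posi addnC -addnA subnK ?modnDr //.
exact: ltnW.
Qed.

(** * The lower bound *)

Section Construction.
Variables k d m : nat.
Hypothesis k_gt0 : 0 < k.
Local Notation l := (k + k).+1.

Definition core := ('I_l * 'I_d * {set 'I_d})%type.
Definition vtx := (core + 'I_l * 'I_m)%type.

(* [inl (0, x, _)] plays the role of [x] and [inl (2k, _, A)] that of [v_A]; their
   ignored components only create twins.  For [0 < i < 2k], [inl (i, x, A)] is the
   [i]-th vertex of the path from [x] to [v_A], which is cut at its first edge
   when [x \in A]. *)
Definition arc (a b : vtx) : bool :=
  match a, b with
  | inl (i, x, A), inl (j, y, B) =>
      (j == i.+1 :> nat) &&
        (if i == 0 :> nat then (x == y) && (y \notin B)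
         else (A == B) && ((j == k + k :> nat) || (x == y)))
      || [&& i == k + k :> nat, j == 0 :> nat & y \in A]
  | inl (i, _, _), inr (j, _) => i == j
  | inr _, inl _ => false
  | inr (i, _), inr (j, _) => (j == i.+1 :> nat) && (~~ odd i || (j == k + k :> nat))
  end.

Definition gadj : rel vtx := fun a b => arc a b || arc b a.

Lemma gadj_sym : symmetric gadj.
Proof. by move=> a b; rewrite /gadj orbC. Qed.

Lemma gadj_irr : irreflexive gadj.
Proof.
case=> [[[i x] A]|[i x]]; rewrite /gadj /= orbb; last by rewrite ltn_eqF.
rewrite (ltn_eqF (ltnSn i)) /=; apply/negP => /and3P[/eqP -> ]; lia.
Qed.

Definition gadget := SGraph gadj_sym gadj_irr.

(** The homomorphism to the cycle. The large set of layer [i] must sit next to [i]: the sets of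
    layers [2j] and [2j + 1] swap places, and that of [2k] goes to [2k - 1], so none has position
    [2k]. *)
Definition gpos (a : vtx) : nat :=
  match a with
  | inl (i, _, _) => i
  | inr (i, _) => if i == k + k :> nat then i.-1 else if odd i then i.-1 else i.+1
  end.

Lemma gpos_lt a : gpos a < l.
Proof.
case: a => [[[i x] A]|[i x]] /=; first exact: ltn_ord.
have := ltn_ord i; case: ifP => [_|]; first by lia.
by case: ifP; lia.
Qed.

Lemma gpos_even (i : 'I_l) x : i < k + k -> ~~ odd i -> gpos (inr (i, x)) = i.+1.
Proof. by move=> lti /negbTE eveni; rewrite /= (ltn_eqF lti) eveni. Qed.

Lemma gpos_odd (i : 'I_l) x : odd i -> gpos (inr (i, x)) = i.-1.
Proof. by move=> oddi; rewrite /= oddi; case: ifP. Qed.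

Lemma gpos_max (i : 'I_l) x : i = k + k :> nat -> gpos (inr (i, x)) = (k + k).-1.
Proof. by move=> E; rewrite /= E eqxx. Qed.

Lemma gpos_arc a b : arc a b ->
  gpos b = (gpos a).+1 %[mod l] \/ gpos a = (gpos b).+1 %[mod l].
Proof.
have kk_gt0 : 0 < k + k by rewrite addn_gt0 k_gt0.
case: a b => [[[i x] A]|[i x]] [[[j y] B]|[j y]] //.
- case/orP=> [/andP[/eqP E _]|/and3P[/eqP E /eqP F _]]; left; first by rewrite /= E.
  by rewrite /= E F modnn mod0n.
- move/eqP=> <-; have := ltn_ord i; rewrite ltnS leq_eqVlt => /orP[/eqP E|lti].
    by right; rewrite gpos_max //= E prednK.
  have [oddi|eveni] := boolP (odd i); last by left; rewrite gpos_even.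
  by right; rewrite gpos_odd //= prednK // odd_gt0.
- case/andP=> /eqP E /orP[ni|/eqP F].
    have lti : i < k + k by rewrite -ltnS -E ltn_ord.
    by right; rewrite gpos_even // gpos_odd E //= ni.
  have F' : i.+1 = k + k by rewrite -E.
  have oddi : odd i by rewrite -[odd i]negbK -[~~ odd i]/(odd i.+1) F' addnn odd_double.
  have F2 : (k + k).-1 = i by exact: esym (congr1 predn F').
  by left; rewrite gpos_max // gpos_odd // prednK ?odd_gt0 // F2.
Qed.

Lemma gpos_gadj a b : gadj a b ->
  gpos b = (gpos a).+1 %[mod l] \/ gpos a = (gpos b).+1 %[mod l].
Proof.
by case/orP=> /gpos_arc // [H|H]; [right|left].
Qed.

(** A walk winding forward from layer [i] cannot enter its large set: for odd [i] this lies behind,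
    and for even [i] all its neighbours are at position [i]. *)
Lemma gadget_step (i : 'I_l) x A (b c : vtx) :
  i < k + k -> gadj (inl (i, x, A)) b -> gadj b c ->
  gpos b = i.+1 -> gpos c = i.+2 %% l ->
  exists j y B, b = inl (j, y, B) /\ arc (inl (i, x, A)) b.
Proof.
move=> lti; case: b => [[[j y] B]|[j y]]; rewrite {1}/gadj.
  case/orP=> [ab _ _ _|]; first by exists j, y, B.
  move=> /= H _ E; exfalso; move: H; rewrite E.
  have -> : (i == i.+2 :> nat) = false by lia.
  by rewrite /= => /and3P[/eqP H /eqP H' _]; lia.
rewrite orbF => /eqP <- gc; have [oddi|eveni] := boolP (odd i).
  by rewrite gpos_odd // => E; move: (leq_pred i); rewrite E ltnn.
have lti2 : i.+2 < l by move: lti eveni; clear; lia.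
rewrite gpos_even // modn_small // => _; move: gc; rewrite {1}/gadj.
case: c => [[[i' x'] A']|[i' x']].
  by move=> /eqP -> /= E; move: (leqnSn i); rewrite -ltnS -{1}E ltnn.
case/orP=> /andP[/eqP E H].
  rewrite gpos_odd ?E //= => F; move: (leqnSn i); by rewrite -ltnS -{1}F ltnn.
move: H; rewrite (ltn_eqF lti) orbF => oddi'.
by move: eveni; rewrite E /= oddi'.
Qed.

Lemma gadget_free : graph_free (cycle_graph l) gadget.
Proof.
move=> [f [injf homf]].
have oddl : odd l by rewrite /= addnn odd_double.
have fe i : gadj (f i) (f (ordS i)).
  apply: homf; rewrite /= /cycle_adj eqxx andbT -val_eqE /=.
  have := ltn_ord i; rewrite ltnS leq_eqVlt => /orP[/eqP->|lti].
    by rewrite modnn; lia.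
  by rewrite modn_small ?ltnS // neq_ltn ltnSn.
have [c [ce cl cpos]] := @cycle_winding vtx gadj gpos l f gadj_sym oddl gpos_lt
  gpos_gadj fe.
have posS j : j < l -> gpos (c j) = j by move=> lt; rewrite cpos modn_small.
have e2k : gadj (c (k + k)) (c 0) by rewrite -cl; exact: ce.
have := posS (k + k) (ltnSn _); have := posS 0 isT.
(* [c (k + k)] is in the core, as no large set has position [2k]; its large neighbours have position
   [2k - 1], so [c 0] is in the core too. *)
move: e2k; case E0 : (c 0) => [[[i0 x] A0]|[i0 x]]; last first.
  case: (c (k + k)) => [[[i y] A]|[i y]] /=.
    rewrite /gadj /= orbF => /eqP <- p0 E; move: p0; rewrite E eqxx; lia.
  move=> _ _; have := ltn_ord i; case: eqP; first by lia.
  by case: ifP; lia.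
move=> e2k /= z0 p2k.
(* The first edge fixes [A] with [x \notin A], and [A] is kept up to layer [2k], where the closing
   edge demands [x \in A]. *)
have inv j : j < k + k -> exists (i : 'I_l) y A, [/\ c j.+1 = inl (i, y, A),
    i = j.+1 :> nat, x \notin A & j.+1 < k + k -> y = x].
  elim: j => [|j IH] ltj.
    have := @gadget_step i0 x A0 (c 1) (c 2); rewrite z0 -E0.
    move=> /(_ ltj (ce 0) (ce 1) (posS 1 (ltj : 1 < l)) (cpos 2)) [i [y [B [E]]]].
    rewrite E0 E /= z0 /= (ltn_eqF ltj) orbF => /andP[/eqP i1 /andP[/eqP xy yB]].
    by exists i, y, B; split=> //; rewrite xy.
  have [i [y [A [E ij xA yx]]]] := IH (ltnW ltj).
  have := @gadget_step i y A (c j.+2) (c j.+3); rewrite ij -E.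
  move=> /(_ ltj (ce _) (ce _) (posS _ (ltj : j.+2 < l)) (cpos _)) [i' [y' [B [E']]]].
  rewrite E' E /= ij /= => /orP[|/and3P[/eqP]]; last by lia.
  case/andP=> /eqP i'j /andP[/eqP AB H].
  exists i', y', B; split=> //; first by rewrite -AB.
  move=> lt; move: H; rewrite i'j (ltn_eqF lt) /= => /eqP <-; apply: yx; lia.
have [|i [y [A [E ij xA _]]]] := inv (k + k).-1; first by lia.
rewrite prednK in E ij; last by lia.
move: e2k; rewrite E /gadj /= ij z0 /= eqxx /= (negbTE xA).
have -> : (0 == k + k) = false by lia.
have -> : (k + k == 1) = false by lia.
by [].
Qed.

(** Each vertex sees one whole large set: a core vertex that of its layer, a vertex of the [i]-th
    large set the previous one if [i] is odd or [2k], and the next one otherwise. *)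
Lemma gadget_degree (a : gadget) : m <= #|nbhd a|.
Proof.
have [i H] : exists i : 'I_l, forall z : 'I_m, gadj a (inr (i, z)).
  case: a => [[[i x] A]|[i x]].
    by exists i => z; rewrite /gadj /= eqxx.
  have := ltn_ord i; rewrite ltnS leq_eqVlt => /orP[/eqP E|lti].
    have lt : i.-1 < l by lia.
    exists (Ordinal lt) => z; rewrite /gadj /=; apply/orP; right.
    by rewrite E eqxx orbT andbT; lia.
  have [oddi|eveni] := boolP (odd i).
    have lt : i.-1 < l by lia.
    exists (Ordinal lt) => z; rewrite /gadj /=; apply/orP; right.
    by apply/andP; split; [lia|apply/orP; left; lia].
  exists (Ordinal (lti : i.+1 < l)) => z; rewrite /gadj /=; apply/orP; left.
  by rewrite eqxx eveni.
rewrite -[leqLHS]card_ord -cardsT -(card_imset (f := fun z : 'I_m =>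
  inr (i, z) : gadget)); last by move=> z z' [].
by apply: subset_leq_card; apply/subsetP => b /imsetP[z _ ->]; rewrite inE; exact: H.
Qed.

Lemma card_gadget : #|gadget| = l * (d * 2 ^ d + m).
Proof.
rewrite card_sum !card_prod !card_ord mulnDr mulnA.
by rewrite (_ : #|{set 'I_d}| = 2 ^ d) // -[LHS]cardsT -powersetT card_powerset
  cardsT card_ord.
Qed.

(** * Maximal extensions of the gadget *)

Section Extension.
Variables (e : rel vtx) (se : symmetric e) (ie : irreflexive e).
Hypotheses (sub : subrel gadj e) (free : graph_free (cycle_graph l) (SGraph se ie)).

(** The edge would close the path of length [2k] from [x] to [v_A] into a forbidden cycle. *)
Lemma gadget_nonadj (x y : 'I_d) (A : {set 'I_d}) :
  x \notin A -> ~~ e (inl (ord_max, y, A)) (inl (ord0, x, set0)).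
Proof.
move=> xA; apply/negP => eyx; apply: free.
(* At the two end layers the ignored components are those of the given vertices. *)
pose f (i : 'I_l) : vtx := inl (i, if i == k + k :> nat then y else x, if i == 0 :>
  nat then set0 else A).
have fS i : e (f i) (f (ordS i)).
  have := ltn_ord i; rewrite ltnS leq_eqVlt => /orP[/eqP E|lti].
    have -> : i = ord_max by apply/val_inj.
    have -> : ordS (ord_max : 'I_l) = ord0 by apply/val_inj; rewrite /= modnn.
    rewrite /f /= !eqxx; have -> : (k + k == 0) = false by lia.
    by have -> : (0 == k + k) = false by lia.
  apply: sub; rewrite /gadj; apply/orP; left; rewrite /= modn_small ?ltnS // eqxx /=.
  apply/orP; left; rewrite (ltn_eqF lti); case: eqP => [->|_].
    have -> : (1 == k + k) = false by lia.
    by rewrite eqxx.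
  by rewrite eqxx /=; case: eqP => //; rewrite eqxx.
exists f; split=> [i j []//|i j].
by case/andP=> _ /orP[/eqP->|/eqP->]; [exact: fS|rewrite /= se; exact: fS].
Qed.

Lemma gadget_VC_dim : 0 < d -> d <= VC_dim (SGraph se ie).
Proof.
move=> d_gt0; pose h (x : 'I_d) : SGraph se ie := inl (ord0, x, set0).
pose S := [set h x | x : 'I_d].
have cS : #|S| = d by rewrite card_imset ?card_ord // => x y [].
apply: (@leq_trans #|S|); first by rewrite cS.
apply: (@leq_bigmax_cond _ (@shattered (SGraph se ie)) (fun S => #|S|) S).
apply/eqP/setP => B; rewrite inE; apply/imsetP/idP => [[v _ ->]|BS];
  first exact: subsetIr.
pose A := [set x | h x \in B]; pose y := Ordinal d_gt0.
exists (inl (ord_max, y, A)) => //; apply/setP => b; rewrite !inE.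
have [/imsetP[x _ ->]|bS] := boolP (b \in S); last first.
  by rewrite andbF; apply/negbTE; apply: contra bS; exact: (subsetP BS).
rewrite andbT; have [xB|xB] := boolP (h x \in B).
  apply/esym; apply: sub; apply/orP; left; apply/orP; right.
  by rewrite /= eqxx inE.
by apply/esym/negbTE; apply: gadget_nonadj; rewrite inE.
Qed.

End Extension.
End Construction.

(** * The value of the threshold *)

(** The comparison with [#|G|] handles the default value of the minimum. *)
Lemma le_min_degree (G : sgraph) (m : nat) :
  m <= #|G| -> (forall v : G, m <= #|nbhd v|) -> m <= min_degree G.
Proof.
move=> mG mv; apply: (big_ind (fun x => m <= x)) => // x y mx my.
by rewrite leq_min mx.
Qed.

(** For fixed [d], the ratio [m / #|G|] tends to [1 / (k + k).+1] as [m] grows. *)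
Lemma large_VC_dim (k d m : nat) : 0 < k -> 0 < d ->
  exists G : sgraph, [/\ maximal_free (cycle_graph (k + k).+1) G,
    #|G| = (k + k).+1 * (d * 2 ^ d + m), m <= min_degree G & d <= VC_dim G].
Proof.
move=> k_gt0 d_gt0.
have [e [se [ie [sub maxi]]]] := maximal_free_extension (@gadget_free k d m k_gt0).
have cG : #|SGraph se ie| = (k + k).+1 * (d * 2 ^ d + m) by exact: card_gadget.
exists (SGraph se ie); split=> //.
  apply: le_min_degree => [|v]; first by rewrite cG (leq_trans (leq_addl (d * 2 ^ d)
    m)) // leq_pmull.
  apply: leq_trans (@gadget_degree k d m k_gt0 v) _.
  by apply: subset_leq_card; apply/subsetP => w; rewrite !inE => /sub.
exact: gadget_VC_dim sub maxi.1 d_gt0.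
Qed.

Import Order.TTheory GRing.Theory Num.Theory.
Local Open Scope ring_scope.

Theorem mainTheorem5 (R : realType) (k : nat) (hk : (1 <= k)%N) :
  VC_threshold R (cycle_graph (2 * k + 1)) = 1 / (2 * k + 1)%:R.
Proof.
have -> : (2 * k + 1)%N = (k + k).+1 by lia.
set l := (k + k).+1; rewrite /VC_threshold; set E := (X in inf X).
have l_gt0 : 0 < l%:R :> R by rewrite ltr0n.
have lbE : classical_sets.lbound E 0 by move=> x [].
have memE e : 0 < e -> E (1 / l%:R + e).
  move=> e_gt0; split; first by rewrite addr_ge0 ?divr_ge0 // ltW.
  (* Then [1 / q < e], so the degree condition gives density at least [1 / l + 1 / q]. *)
  pose q := Num.bound e^-1.
  have qe : 1 < q%:R * e.
    by rewrite -ltr_pdivrMr // mul1r archi_boundP // invr_ge0 ltW.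
  have q_gt0 : (0 < q)%N by rewrite lt0n; apply: contraTneq qe => ->;
    rewrite mul0r ltr10.
  exists (VC_bound k q) => G Gmax deg.
  apply: VC_dim_bounded => //; rewrite -(ler_nat R) !natrM natrD -/l.
  apply: le_trans (ler_wpM2l _ deg); last by rewrite mulr_ge0.
  rewrite mulrA ler_wpM2r // mulrDr div1r (mulrC l%:R) mulfK ?gt_eqF // lerD2l.
  by rewrite mulrAC ler_peMl // ltW.
apply/le_anti/andP; split.
  by apply/ler_addgt0Pr => e /memE Ee; apply: ge_inf => //; exists 0.
apply: lb_le_inf; first by exists (1 / l%:R + 1); apply: memE.
move=> g [g_ge0 [C HC]]; rewrite leNgt; apply/negP => glt.
have gl : g * l%:R < 1 by rewrite -ltr_pdivlMr.
pose N := (C.+1 * 2 ^ C.+1)%N.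
(* So large that [g * l * (N + m) <= m], where [l * (N + m)] is the order of the graph built with
   [d = C.+1]. *)
pose m := Num.bound (g * l%:R * N%:R / (1 - g * l%:R)).
have mP : g * l%:R * N%:R < m%:R * (1 - g * l%:R).
  rewrite -ltr_pdivrMr ?subr_gt0 // archi_boundP //.
  by rewrite divr_ge0 ?subr_ge0 ?(ltW gl) // !mulr_ge0.
have [G [Gmax cG degG dG]] := @large_VC_dim k C.+1 m hk isT.
suff /(HC G Gmax) : g * #|G|%:R <= (min_degree G)%:R by rewrite leqNgt dG.
apply: (@le_trans _ _ m%:R); last by rewrite ler_nat.
rewrite cG natrM natrD mulrA mulrDr -/l -/N; lra.
Qed.
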